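(* Given $m\in\mathbb{N}$ and $\lambda\in(0,1]$, for any $\epsilon<\frac{m-1}{m}\lambda$, the deterministic profile query complexity of finding $\epsilon$-approximate correlated equilibria of $n$-player, $m$-action, $\lambda$-Lipschitz games is $2^{\Omega(n)}$.
   Context: Games. An $n$-player, $m$-action game has players $[n]=\{1,\dots,n\}$, each with action set $[m]=\{1,\dots,m\}$, and payoff functions $u_i:[m]^n\to[0,1]$. For $\lambda\in(0,1]$ it is $\lambda$-Lipschitz if a change of action of any single player changes the payoff of any other player by at most $\lambda$; i.e. for every player $i$ and all profiles $\mathbf{a},\mathbf{a}'$ with $a_i=a_i'$, $|u_i(\mathbf{a})-u_i(\mathbf{a}')|\le\lambda\cdot|\{i'\ne i: a_{i'}\neq a'_{i'}\}|$. Correlated equilibria. A correlated strategy profile is a probability distribution $\mathbf{X}\in\Delta([m]^n)$ over pure action profiles. For player $i$ and $\phi:[m]\to[m]$ let $u_i(\mathbf{X})=\mathbb{E}_{\mathbf{a}\sim\mathbf{X}}[u_i(\mathbf{a})]$ and $u_i^{(\phi)}(\mathbf{X})=\mathbb{E}_{\mathbf{a}\sim\mathbf{X}}[u_i(\phi(a_i),\mathbf{a}_{-i})]$, where $\mathbf{a}_{-i}$ denotes the actions of the players other than $i$. $\mathbf{X}$ is an $\epsilon$-approximate correlated equilibrium if $\max_{\phi:[m]\to[m]}\big(u_i^{(\phi)}(\mathbf{X})-u_i(\mathbf{X})\big)\le\epsilon$ for every $i\in[n]$. Queries. A (possibly adaptive) algorithm accesses the game only through profile queries: a profile query of a pure action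 profile $\mathbf{a}$ returns the vector $(u_i(\mathbf{a}))_{i\in[n]}$. The deterministic profile query complexity of finding $\epsilon$-approximate correlated equilibria is the minimum, over deterministic algorithms that on every game in the stated class output an $\epsilon$-approximate correlated equilibrium, of the worst-case number of profile queries made. The asymptotics are as $n\to\infty$ with $m,\lambda,\epsilon$ fixed; the constant in $\Omega$ may depend on them. *)

(* Defs.v *)
From mathcomp Require Import all_boot all_order all_algebra.
From mathcomp Require Import all_classical all_reals all_analysis.

Set Implicit Arguments.
Unset Strict Implicit.
Unset Printing Implicit Defensive.

Import Order.TTheory GRing.Theory Num.Theory.

Local Open Scope classical_set_scope.
Local Open Scope ring_scope.

Definition profile (n m : nat) := {ffun 'I_n -> 'I_m}.

(* The profile (b, a_{-i}). *)
Definition deviate (n m : nat) (a : profile n m) (i : 'I_n) (b : 'I_m) :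
    profile n m :=
  [ffun j => if j == i then b else a j].

Record game (R : realType) (n m : nat) := Game {
  payoff :> 'I_n -> profile n m -> R;
  payoff_itv : forall i a, 0 <= payoff i a <= 1
}.

(* Only changes of the actions of the other players are constrained: a
   player's own action may change that player's payoff arbitrarily in [0, 1]. *)
Definition lipschitz_game (R : realType) (n m : nat) (lambda : R)
    (u : game R n m) : Prop :=
  forall (i : 'I_n) (a a' : profile n m), a i = a' i ->
    `|u i a - u i a'| <=
      lambda * #|[set i' : 'I_n | (i' != i) && (a i' != a' i')]%SET|%:R.

Record correlated_profile (R : realType) (n m : nat) := CorrelatedProfile {
  pmf :> profile n m -> R;
  pmf_ge0 : forall a, 0 <= pmf a;
  pmf_sum1 : \sum_(a : profile n m) pmf a = 1
}.

Definition expect (R : realType) (n m : nat) (X : correlated_profile R n m)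
    (f : profile n m -> R) : R :=
  \sum_(a : profile n m) X a * f a.

Definition exp_payoff (R : realType) (n m : nat) (u : game R n m)
    (i : 'I_n) (X : correlated_profile R n m) : R :=
  expect X (u i).

Definition exp_payoff_swap (R : realType) (n m : nat) (u : game R n m)
    (i : 'I_n) (phi : 'I_m -> 'I_m) (X : correlated_profile R n m) : R :=
  expect X (fun a => u i (deviate a i (phi (a i)))).

Definition approx_correlated_eq (R : realType) (n m : nat) (eps : R)
    (u : game R n m) (X : correlated_profile R n m) : Prop :=
  forall (i : 'I_n) (phi : 'I_m -> 'I_m),
    exp_payoff_swap u i phi X - exp_payoff u i X <= eps.

(* Deterministic adaptive algorithms, as decision trees branching on the payoff
   vector returned by each profile query. Well-foundedness loses no generality:
   there are finitely many profiles, so along an infinite sequence of answers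
   all of whose prefixes come from games of a class, the answers all come from
   one game of the class, on which the algorithm would not halt. *)
Inductive query_alg (R : realType) (n m : nat) : Type :=
| Output of correlated_profile R n m
| Query of profile n m & ({ffun 'I_n -> R} -> query_alg R n m).

Definition answer (R : realType) (n m : nat) (u : game R n m)
    (a : profile n m) : {ffun 'I_n -> R} :=
  [ffun i => u i a].

Fixpoint run (R : realType) (n m : nat) (A : query_alg R n m)
    (u : game R n m) : correlated_profile R n m :=
  match A with
  | Output X => X
  | Query a k => run (k (answer u a)) u
  end.

Fixpoint num_queries (R : realType) (n m : nat) (A : query_alg R n m)
    (u : game R n m) : nat :=
  match A with
  | Output _ => 0%N
  | Query a k => (num_queries (k (answer u a)) u).+1
  end.

Definition finds_correlated_eq (R : realType) (n m : nat) (lambda eps : R)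
    (A : query_alg R n m) : Prop :=
  forall u : game R n m, lipschitz_game lambda u ->
    approx_correlated_eq eps u (run A u).

Definition worst_case_queries (R : realType) (n m : nat) (lambda : R)
    (A : query_alg R n m) : \bar R :=
  ereal_sup [set ((num_queries A u)%:R%:E : \bar R)
            | u in [set u : game R n m | lipschitz_game lambda u]].

(* Equal to +oo when no algorithm succeeds on the whole class, in particular
   when eps < 0 < n. *)
Definition det_query_complexity (R : realType) (n m : nat) (lambda eps : R) :
    \bar R :=
  ereal_inf [set worst_case_queries lambda A
            | A in [set A : query_alg R n m | finds_correlated_eq lambda eps A]].

(* Main.v *)
(* Payoffs in {0, lambda} are automatically lambda-Lipschitz.  The adversary lists
   profiles, a superset of the queried ones, and answers u_i(a) = lambda exactly
   when an earlier profile of the list differs from a in coordinate i only.  A set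
   of fewer than 2^d profiles always has a member with fewer than d directions into
   the set; hence the list can be closed off so that it stays at most twice as long
   as the query sequence, every listed profile has at most 3d directions to earlier
   ones, and every unlisted profile has fewer than 2d directions to the list.
   Given the output X, choose for each player i an action b_i of marginal
   probability at most 1/m and let u_i = lambda * [a_i = b_i] at unlisted profiles.
   For all but 3d players per profile a with a_i <> b_i, switching to b_i gains
   lambda, so on average over i the regret of "always play b_i" is at least
   lambda * ((m - 1) / m - 6d / n), which exceeds eps when d is a small multiple
   of n. *)
Require Import Defs.
From mathcomp Require Import all_boot all_order all_algebra.
From mathcomp Require Import all_classical all_reals all_analysis.
From mathcomp Require Import fintype finset zify lra.

Import Order.TTheory GRing.Theory Num.Theory.
Local Open Scope ring_scope.

(** * Collinear profiles in the Hamming graph and the adversary's list *)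

Section Lines.
Local Open Scope nat_scope.
Local Open Scope set_scope.
Context {n m : nat}.
Implicit Types (S : {set profile n m}) (a x y : profile n m) (i : 'I_n).
Implicit Types (s r : seq (profile n m)).

Lemma deviate_id a i : deviate a i (a i) = a.
Proof. by apply/ffunP => j; rewrite ffunE; case: eqP => // ->. Qed.

Lemma deviateK a i b : deviate (deviate a i b) i (a i) = a.
Proof. by apply/ffunP => j; rewrite !ffunE; case: eqP => // ->. Qed.

Lemma deviate_deviate a i b c : deviate (deviate a i b) i c = deviate a i c.
Proof. by apply/ffunP => j; rewrite !ffunE; case: eqP. Qed.

Definition dirs S a : {set 'I_n} :=
  [set i | [exists b, (b != a i) && (deviate a i b \in S)]].

Lemma dirsP S a i :
  reflect (exists2 b, b != a i & deviate a i b \in S) (i \in dirs S a).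
Proof.
rewrite inE; apply: (iffP existsP) => [[b /andP[]]|[b ba bS]]; first by exists b.
by exists b; rewrite ba.
Qed.

Lemma dirs_sub S S' a : S \subset S' -> dirs S a \subset dirs S' a.
Proof.
move=> /subsetP SS'; apply/subsetP => i /dirsP[b ba bS].
by apply/dirsP; exists b => //; apply: SS'.
Qed.

Lemma dirs0 a : dirs set0 a = set0.
Proof. by apply/setP => i; rewrite in_set0; apply/dirsP => -[b _]; rewrite inE. Qed.

Lemma dirs_setU S S' a : dirs (S :|: S') a = dirs S a :|: dirs S' a.
Proof.
apply/setP => i; rewrite in_setU; apply/dirsP/orP => [[b ba]|].
  by rewrite in_setU => /orP[] bS; [left|right]; apply/dirsP; exists b.
by case=> /dirsP[b ba bS]; exists b; rewrite // in_setU bS ?orbT.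
Qed.

(** Induction on [d]: splitting [S] by whether coordinate [i] equals [a i], for a direction [i] of
    some [a], gives two nonempty halves, and each point keeps all its directions except possibly
    [i]. *)
Lemma card_dirs_ge d S : S != set0 -> (forall a, a \in S -> d <= #|dirs S a|) ->
  2 ^ d <= #|S|.
Proof.
elim: d S => [|d IH] S S0 dS; first by rewrite expn0 card_gt0.
have [a aS] := set0Pn _ S0.
have /card_gt0P[i /dirsP[b ba bS]] : 0 < #|dirs S a|.
  by apply: leq_trans (dS a aS).
have half (P : pred 'I_m) : [set x in S | P (x i)] != set0 ->
    2 ^ d <= #|[set x in S | P (x i)]|.
  move=> P0; apply: IH => // x; rewrite inE => /andP[xS Px].
  have : #|dirs S x :\ i| <= #|dirs [set x in S | P (x i)] x|.
    apply/subset_leq_card/subsetP => j; rewrite in_setD1 => /andP[ji].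
    move=> /dirsP[c cx cS]; apply/dirsP; exists c => //.
    by rewrite inE cS ffunE eq_sym (negbTE ji).
  by apply: leq_trans; have := dS x xS; rewrite (cardsD1 i); case: (i \in _); lia.
rewrite expnS mul2n -addnn -(cardsID [set x : profile n m | x i == a i] S).
have -> : S :&: [set x : profile n m | x i == a i] = [set x in S | x i == a i].
  by apply/setP => x; rewrite !inE.
have -> : S :\: [set x : profile n m | x i == a i] = [set x in S | x i != a i].
  by apply/setP => x; rewrite !inE andbC.
apply: leq_add; [apply: (half (pred1 (a i)))|apply: (half (predC1 (a i)))].
  by apply/set0Pn; exists a; rewrite inE aS /=.
by apply/set0Pn; exists (deviate a i b); rewrite inE bS /= ffunE eqxx.
Qed.

Definition line a i : {set profile n m} := [set deviate a i b | b : 'I_m].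

Lemma line_eqP a x i : reflect (x = deviate a i (x i)) (line x i == line a i).
Proof.
apply: (iffP eqP) => [xa|->]; last first.
  by apply/setP => y; apply/imsetP/imsetP => -[b _ ->]; exists b;
    rewrite ?deviate_deviate.
have : x \in line x i by apply/imsetP; exists (x i); rewrite ?deviate_id.
by rewrite xa => /imsetP[b _ ->]; rewrite !ffunE eqxx.
Qed.

Lemma mem_line_imset S a i : a \notin S ->
  (line a i \in [set line x i | x in S]) = (i \in dirs S a).
Proof.
move=> aS; apply/imsetP/dirsP => [[x xS /eqP]|[b ba bS]].
  rewrite eq_sym => /line_eqP xE; exists (x i); last by rewrite -xE.
  by apply: contraNneq aS => xa; rewrite -(deviate_id a i) -xa -xE.
exists (deviate a i b) => //; apply/eqP; rewrite eq_sym; apply/line_eqP.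
by rewrite ffunE eqxx.
Qed.

(* The sum, over all lines L meeting S, of #|L :&: S| - 1: the number of
   collinearities created when S is built up one point at a time, in any order. *)
Definition excess S := \sum_i (#|S| - #|[set line x i | x in S]|).

Lemma excess0 : excess set0 = 0.
Proof. by rewrite /excess big1 // => i _; rewrite cards0. Qed.

(** In coordinate [i] the new point also brings a new line, which cancels it, unless its line
    already meets [S]. *)
Lemma excessU1 S a : a \notin S -> excess (a |: S) = excess S + #|dirs S a|.
Proof.
move=> aS; have -> : #|dirs S a| = \sum_i (i \in dirs S a).
  by rewrite -sum1_card big_mkcond; apply: eq_bigr => i _; case: (i \in _).
rewrite /excess -big_split /=; apply: eq_bigr => i _.
rewrite imsetU1 !cardsU1 aS -mem_line_imset //.
have : #|[set line x i | x in S]| <= #|S| by apply: leq_imset_card.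
by move: (#|S|) (#|[set _ | _ in S]|) => p q; case: (_ \in _) => /=; lia.
Qed.

(* When a is not in s, [index a s] is [size s], so every point of s counts as
   earlier than a. *)
Definition back s a := dirs [set x in take (index a s) s] a.

Lemma back_notin s a : a \notin s -> back s a = dirs [set x in s] a.
Proof. by move=> /memNindex as_; rewrite /back as_ take_size. Qed.

Lemma back_cat s r a : a \in s -> back (s ++ r) a = back s a.
Proof. by move=> as_; rewrite /back index_cat as_ take_cat index_mem as_. Qed.

Lemma back_cat_notin s r a : a \notin s ->
  back (s ++ r) a = dirs [set x in s] a :|: back r a.
Proof.
move=> as_; rewrite /back index_cat (negbTE as_) take_cat ltnNge leq_addr /=.
rewrite addKn -dirs_setU; congr dirs.
by apply/setP => x; rewrite !inE mem_cat.
Qed.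

(** Whichever of the two collinear points comes later sees the other. *)
Lemma back_total s a i b : b != a i -> deviate a i b \in s ->
  (i \in back s a) || (i \in back s (deviate a i b)).
Proof.
move=> ba bs; have [lt|] := ltnP (index (deviate a i b) s) (index a s).
  by apply/orP; left; apply/dirsP; exists b => //; rewrite inE in_take.
rewrite leq_eqVlt => /orP[/eqP eq_index|lt].
  have as_ : a \in s by rewrite -index_mem eq_index index_mem.
  have := nth_index a bs; rewrite -eq_index nth_index // => aE.
  by move: ba; rewrite aE ffunE eqxx eqxx.
have as_ : a \in s by rewrite -index_mem (leq_trans lt) // index_size.
apply/orP; right; apply/dirsP; exists (a i).
  by rewrite ffunE eqxx eq_sym.
by rewrite inE deviateK in_take.
Qed.

Lemma set_nil : [set x in [::]] = set0 :> {set profile n m}.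
Proof. by apply/setP => x; rewrite !inE. Qed.

(** By [card_dirs_ge] some point has fewer than [d] directions; it is placed last and the rest is
    ordered recursively. *)
Lemma degenerate_order d S : #|S| < 2 ^ d ->
  exists s, [/\ uniq s, [set x in s] = S, forall a, a \in s -> #|back s a| < d &
    excess S <= d * #|S|].
Proof.
have [k] := ubnP #|S|; elim: k S => // k IH S Sk Sd.
have [->|S0] := eqVneq S set0.
  by exists [::]; split; rewrite ?set_nil ?excess0.
have [a aS ad] : exists2 a, a \in S & #|dirs S a| < d.
  apply/exists_inP; apply: contraLR Sd => /exists_inPn Sd.
  by rewrite -leqNgt card_dirs_ge // => a /Sd; rewrite -leqNgt.
have cS := cardsD1 a S; rewrite aS in cS.
have [||s [us sE sd es]] := IH (S :\ a); [lia|lia|].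
have as_ : a \notin s by have := setD11 a S; rewrite -sE inE => ->.
have Sa_d : #|dirs (S :\ a) a| < d.
  exact: leq_ltn_trans (subset_leq_card (dirs_sub _ _ a (subsetDl _ _))) ad.
exists (s ++ [:: a]); split.
- by rewrite cats1 rcons_uniq as_.
- by rewrite -(setD1K aS) -sE; apply/setP => x; rewrite !inE mem_cat !inE orbC.
- move=> x; rewrite mem_cat => /orP[xs|]; first by rewrite back_cat ?sd.
  rewrite inE => /eqP ->; rewrite back_cat_notin // sE /back /= eqxx /=.
  by rewrite set_nil dirs0 setU0.
- rewrite -(setD1K aS) excessU1 ?setD11 // setD1K //; nia.
Qed.

(** Here [t] counts answered queries. The fourth clause is an accounting: every listed profile costs
    [2 * d], paid by collinearities except for [t] free profiles. *)
Definition state d t s :=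
  [/\ uniq s, forall a, #|back s a| <= 3 * d,
      forall a, a \notin s -> #|back s a| < 2 * d,
      2 * d * size s <= excess [set x in s] + 2 * d * t & size s < 2 ^ d].

Lemma state0 d : 0 < d -> state d 0 [::].
Proof.
move=> d0; have back0 a : back [::] a = set0 by rewrite back_notin // set_nil dirs0.
split => // [a|a _||]; rewrite ?back0 ?cards0 ?muln0 ?expn_gt0 //; lia.
Qed.

(* Taking a maximal set satisfying the excess inequality makes every point
   outside it have few collinearities, since any other point could be added. *)
Lemma state_extend d t s q : 1 < d -> t < 2 ^ (d - 2) -> state d t s ->
  exists2 r, state d t.+1 (s ++ r) & q \in s ++ r.
Proof.
move=> d1 tT [us s3 s2 se sd].
(* Combined with [excess S <= d * #|S|], the accounting gives [#|S| <= 2 * u], at most half of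
   [2 ^ d]. *)
have room S u : u <= 2 ^ (d - 2) -> 2 * d * #|S| <= excess S + 2 * d * u ->
    #|S| < 2 ^ d -> #|S|.+1 < 2 ^ d.
  move=> uT Se Sd; have [_ [_ _ _ eS]] := degenerate_order _ _ Sd.
  have S2u : #|S| <= 2 * u by nia.
  have : 2 ^ d = 4 * 2 ^ (d - 2) by rewrite -(expnD 2 2); congr (_ ^ _); lia.
  have := expn_gt0 2 (d - 2); lia.
pose P S := (2 * d * #|S| <= excess S + 2 * d * t.+1) && (#|S| < 2 ^ d).
have cs : #|[set x in s]| = size s by rewrite cardsE; apply/card_uniqP.
have Pq : P (q |: [set x in s]).
  have [qs|qs] := boolP (q \in [set x in s]).
    by rewrite (setUidPr _) ?sub1set // /P cs sd andbT; lia.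
  rewrite /P excessU1 // cardsU1 qs (room _ _ (ltnW tT)) ?cs // andbT; nia.
have [S /maxsetP[/andP[Se Sd] Smax] qS] := maxset_exists Pq.
have Sfew a : a \notin S -> #|dirs S a| < 2 * d.
  move=> aS; rewrite ltnNge; apply/negP => da.
  suff /Smax : P (a |: S).
    by move=> /(_ (subsetUr _ _)) SE; rewrite -SE setU11 in aS.
  rewrite /P excessU1 // cardsU1 aS (room S _ tT) // andbT; nia.
have sS x : x \in s -> x \in S.
  by move=> xs; apply: (subsetP qS); rewrite !inE xs orbT.
(* In this order a new point sees fewer than [d] directions to earlier new points, on top of fewer
   than [2 * d] to [s]; hence the bound [3 * d]. *)
have [|r [ur rE rd _]] := degenerate_order d (S :\: [set x in s]).
  exact: leq_ltn_trans (subset_leq_card (subsetDl _ _)) Sd.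
have rP x : (x \in r) = (x \notin s) && (x \in S).
  by have := in_set (mem r) x; rewrite rE !inE => <-.
have srP x : (x \in s ++ r) = (x \in S).
  by rewrite mem_cat rP; have := sS x; case: (x \in s) => // ->.
have srE : [set x in s ++ r] = S by apply/setP => x; rewrite inE srP.
have usr : uniq (s ++ r).
  by rewrite cat_uniq us ur andbT; apply/hasPn => x; rewrite rP => /andP[].
have csr : size (s ++ r) = #|S| by rewrite -srE cardsE; apply/esym/card_uniqP.
have sr2 a : a \notin s ++ r -> #|back (s ++ r) a| < 2 * d.
  by move=> asr; rewrite back_notin // srE Sfew // -srP.
exists r; last by rewrite srP (subsetP qS) ?setU11.
split => //; rewrite ?csr ?srE // => a.
have [asr|/sr2] := boolP (a \in s ++ r); last lia.
have [as_|as_] := boolP (a \in s); first by rewrite back_cat.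
have ar : a \in r by move: asr; rewrite mem_cat (negbTE as_).
rewrite back_cat_notin // -back_notin //.
apply: leq_trans (leq_card_setU _ _).1 _.
by have := s2 a as_; have := rd a ar; lia.
Qed.

End Lines.

(** * Games that fit the adversary's answers and defeat a given output *)

Section HardGames.
Context {R : realType} {n m : nat} (lambda : R).
Hypotheses (lambda0 : 0 < lambda) (lambda1 : lambda <= 1).
Implicit Types (a : profile n m) (i : 'I_n) (b : 'I_n -> 'I_m).
Implicit Types (s : seq (profile n m)) (X : correlated_profile R n m).

Definition hard_payoff s b i a : bool :=
  if a \in s then i \in back s a else a i == b i.

Lemma hard_game_subproof s b i a :
  0 <= lambda * (hard_payoff s b i a)%:R <= 1.
Proof.
by case: hard_payoff;
  rewrite /= ?mulr1 ?mulr0 ?lexx ?ler01 ?lambda1 ?(ltW lambda0).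
Qed.

Definition hard_game s b := Game (hard_game_subproof s b).

Lemma hard_gameE s b i a : hard_game s b i a = lambda * (hard_payoff s b i a)%:R.
Proof. by []. Qed.

(* Payoffs in {0, lambda} make the Lipschitz condition vacuous. *)
Lemma hard_game_lipschitz s b : lipschitz_game lambda (hard_game s b).
Proof.
move=> i a a' eq_i; rewrite !hard_gameE -mulrBr normrM gtr0_norm //.
rewrite ler_wpM2l ?(ltW lambda0) //.
have [->|aa'] := eqVneq a a'; first by rewrite subrr normr0 ler0n.
suff : (0 < #|[set i' : 'I_n | (i' != i) && (a i' != a' i')]%SET|)%N.
  by move=> c; apply: le_trans (_ : 1 <= _); rewrite ?ler1n //;
    do 2!case: hard_payoff => /=;
    rewrite ?subrr ?subr0 ?sub0r ?normrN ?normr1 ?normr0.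
apply/card_gt0P; suff [j aj] : exists j, a j != a' j.
  by exists j; rewrite inE aj andbT; apply: contraNneq aj => ->; rewrite eq_i.
apply/existsP; apply: contraNT aa' => /existsPn aj.
by apply/eqP/ffunP => j; apply/eqP; have := aj j; rewrite negbK.
Qed.

(** The factor 2 pushes the left side down to at most -1 when [i] is in [back s a]. Otherwise, if
    [a i != b i], the payoff at [a] is 0, and the deviation earns 1, by [back_total] if it is
    listed. *)
Lemma hard_payoff_deviate s b i a :
  (a i != b i)%:R - 2 * (i \in back s a)%:R <=
  (hard_payoff s b i (deviate a i (b i)))%:R - (hard_payoff s b i a)%:R :> R.
Proof.
have [ab|ab] := eqVneq (a i) (b i).
  by rewrite -ab deviate_id subrr sub0r oppr_le0 mulr_ge0 ?ler0n.
have [ia|ia] := boolP (i \in back s a); first by do 2!case: hard_payoff => /=; lra.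
have -> : hard_payoff s b i a = false.
  by rewrite /hard_payoff (negbTE ia) (negbTE ab) if_same.
suff -> : hard_payoff s b i (deviate a i (b i)) by rewrite /=; lra.
rewrite /hard_payoff ffunE eqxx eqxx; case: ifP => // bs.
have := back_total s a i (b i); rewrite eq_sym ab bs (negbTE ia).
exact.
Qed.

Lemma rare_action X i : (0 < m)%N ->
  exists c, \sum_(a : profile n m | a i == c) X a <= m%:R^-1.
Proof.
move=> m0; apply: contrapT => /forallNP rare.
have : \sum_(c < m) m%:R^-1 < \sum_(c < m) \sum_(a : profile n m | a i == c) X a.
  apply: ltr_sum => [|c _].
    by apply/hasP; exists (Ordinal m0); rewrite ?mem_index_enum.
  by rewrite ltNge; apply/negP/rare.
rewrite sumr_const card_ord -(mulr_natl m%:R^-1) mulfV ?pnatr_eq0 -?lt0n //.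
rewrite -[X in X < _](Defs.pmf_sum1 X).
by rewrite (partition_big (fun a : profile n m => a i) xpredT) //= ltxx.
Qed.

Lemma hard_game_regret k s X eps : (0 < m)%N ->
  (forall a, (#|back s a| <= k)%N) ->
  2 * lambda * k%:R < n%:R * ((m%:R - 1) / m%:R * lambda - eps) ->
  exists b, ~ approx_correlated_eq eps (hard_game s b) X.
Proof.
move=> m0 sk small.
have [b rare] := choice (fun i => rare_action X i m0).
exists b => ce.
have regret i : lambda * \sum_(a : profile n m)
    X a * ((a i != b i)%:R - 2 * (i \in back s a)%:R) <= eps.
  apply: le_trans (ce i (fun=> b i)).
  rewrite /exp_payoff_swap /exp_payoff /expect -sumrB mulr_sumr.
  apply: ler_sum => a _; rewrite -mulrBr mulrCA.
  apply: ler_wpM2l; first exact: Defs.pmf_ge0.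
  by rewrite !hard_gameE -mulrBr ler_wpM2l ?(ltW lambda0) ?hard_payoff_deviate.
have often i : (m%:R - 1) / m%:R <= \sum_(a : profile n m) X a * (a i != b i)%:R.
  have -> : \sum_(a : profile n m) X a * (a i != b i)%:R =
      \sum_(a : profile n m | a i != b i) X a.
    rewrite [RHS]big_mkcond; apply: eq_bigr => a _.
    by case: eqP => _; rewrite ?mulr0 ?mulr1.
  have := Defs.pmf_sum1 X; rewrite (bigID (fun a : profile n m => a i == b i)) /=.
  rewrite mulrBl mul1r mulfV ?pnatr_eq0 -?lt0n //.
  by have := rare i; lra.
(* After exchanging the sums, each profile accounts for at most [k] players. *)
have few : \sum_i \sum_(a : profile n m) X a * (i \in back s a)%:R <= k%:R.
  rewrite (_ : k%:R = \sum_(a : profile n m) X a * k%:R); last first.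
    by rewrite -mulr_suml Defs.pmf_sum1 mul1r.
  rewrite exchange_big /=.
  apply: ler_sum => a _; rewrite -mulr_sumr.
  apply: ler_wpM2l; first exact: Defs.pmf_ge0.
  by rewrite -natr_sum ler_nat -big_mkcond sum1_card.
have : \sum_(i < n) ((m%:R - 1) / m%:R * lambda - eps) <=
    \sum_i 2 * lambda * (\sum_(a : profile n m) X a * (i \in back s a)%:R).
  apply: ler_sum => i _; have := regret i.
  under eq_bigr => a _ do rewrite mulrBr mulrCA.
  rewrite sumrB -mulr_sumr; have := ler_wpM2l (ltW lambda0) (often i).
  move: (\sum_a _) (\sum_a _) ((m%:R - 1) / m%:R) => p q g; lra.
rewrite sumr_const card_ord -[_ *+ n]mulr_natl -mulr_sumr.
have : 2 * lambda * (\sum_i \sum_(a : profile n m) X a * (i \in back s a)%:R) <=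
    2 * lambda * k%:R by rewrite ler_pM2l // mulr_gt0.
by move=> le_k /le_trans/(_ le_k)/le_lt_trans/(_ small); rewrite ltxx.
Qed.

(** The prescribed answers do not depend on [b], and by [back_cat] they survive every extension of
    the list. *)
Definition consistent s (u : game R n m) :=
  lipschitz_game lambda u /\
  forall a i, a \in s -> u i a = lambda * (i \in back s a)%:R.

Lemma hard_game_consistent s b : consistent s (hard_game s b).
Proof.
split; first exact: hard_game_lipschitz.
by move=> a i as_; rewrite hard_gameE /hard_payoff as_.
Qed.

Lemma consistent_cat s r u : consistent (s ++ r) u -> consistent s u.
Proof.
move=> [lip_u uE]; split=> // a i as_.
by rewrite uE ?mem_cat ?as_ // back_cat.
Qed.

(** Induction on the decision tree, with [k] the remaining query budget; an output before it is
    spent is refuted by a game chosen after seeing [X]. *)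
Lemma adversary d eps (A : query_alg R n m) k t s : (0 < m)%N -> (1 < d)%N ->
  6 * lambda * d%:R < n%:R * ((m%:R - 1) / m%:R * lambda - eps) ->
  (t + k = 2 ^ (d - 2))%N -> state d t s ->
  exists2 u, consistent s u &
    approx_correlated_eq eps u (run A u) -> (k <= num_queries A u)%N.
Proof.
move=> m0 d1 small; elim: A k t s => [X|q next IH] [|k] t s tk st.
- exists (hard_game s (fun=> Ordinal m0)) => //; exact: hard_game_consistent.
- have [_ s3 _ _ _] := st.
  have [|b nce] := @hard_game_regret _ s X eps m0 s3.
    by apply: le_lt_trans small; rewrite natrM; nra.
  by exists (hard_game s b) => //; exact: hard_game_consistent.
- exists (hard_game s (fun=> Ordinal m0)) => //; exact: hard_game_consistent.
have tT : (t < 2 ^ (d - 2))%N by rewrite -tk -addSnnS leq_addr.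
have [r str qr] := state_extend _ _ _ q d1 tT st.
(* This answer is fixed before [u] exists, so the induction hypothesis applies to the branch
   [next v]. *)
pose v := [ffun i => lambda * (i \in back (s ++ r) q)%:R].
have [|u uc uk] := IH v k t.+1 (s ++ r) _ str; first by rewrite addSnnS.
exists u; first exact: consistent_cat uc.
have av : answer u q = v by apply/ffunP => i; rewrite !ffunE uc.2.
by rewrite /= av ltnS.
Qed.

End HardGames.

Lemma det_query_complexity_ge (R : realType) (n m d : nat) (lambda eps : R) :
  (0 < m)%N -> 0 < lambda -> lambda <= 1 -> (1 < d)%N ->
  6 * lambda * d%:R < n%:R * ((m%:R - 1) / m%:R * lambda - eps) ->
  ((2 ^ (d - 2))%:R%:E <= det_query_complexity n m lambda eps)%E.
Proof.
move=> m0 lambda0 lambda1 d1 small; apply: le_ereal_inf_tmp => _ [A Aeps <-].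
have [|u [lip_u _] uk] := adversary lambda lambda0 lambda1 d eps A
    (2 ^ (d - 2)) 0 [::] m0 d1 small (add0n _).
  by apply: state0; exact: ltnW.
apply: (@le_trans _ _ (num_queries A u)%:R%:E).
  by rewrite lee_fin ler_nat uk //; exact: Aeps.
by apply: ereal_sup_ubound; exists u.
Qed.

Theorem corollary4 (R : realType) (m : nat) (lambda eps : R)
    (hm : (0 < m)%N) (hlambda0 : 0 < lambda) (hlambda1 : lambda <= 1)
    (heps : eps < (m%:R - 1) / m%:R * lambda) :
  exists c : R, 0 < c /\
    exists N : nat, forall n : nat, (N <= n)%N ->
      ((2 `^ (c * n%:R))%:E <= det_query_complexity n m lambda eps)%E.
Proof.
set gap := (m%:R - 1) / m%:R * lambda - eps.
have gap0 : 0 < gap by rewrite subr_gt0.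
(* The choice [d = n %/ q] gives [6 * d < n * gap]. *)
pose q := (Num.truncn (6 / gap)).+1.
have q_gap : 6 < q%:R * gap by rewrite -ltr_pdivrMr // truncnS_gt.
have q0 : 0 < q%:R :> R by rewrite ltr0n.
(* The factor 2 absorbs both the rounding in [n %/ q] and the [- 2] in the exponent, once [n %/ q]
   is at least 6. *)
exists (2 * q%:R)^-1; split; first by rewrite invr_gt0 mulr_gt0.
exists (6 * q)%N => n nq.
have n_lt : (n < (n %/ q).+1 * q)%N by rewrite ltn_ceil.
have d6 : (6 <= n %/ q)%N by rewrite leq_divRL.
have dn : (n %/ q)%:R * q%:R <= n%:R :> R by rewrite -natrM ler_nat leq_trunc_div.
apply: le_trans (_ : ((2 ^ (n %/ q - 2))%:R%:E <= _)%E); last first.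
  apply: det_query_complexity_ge => //; first exact: leq_trans d6.
  rewrite -/gap; move: d6 dn; rewrite -(ler_nat R); nra.
rewrite lee_fin natrX -powR_mulrn //; apply: ler_powR; first by rewrite ler1n.
rewrite mulrC ler_pdivrMr ?mulr_gt0 // -!natrM ler_nat; nia.
Qed.
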